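(* Consider the stochastic system $$dx=f(x)\,dt+g_1(x)\,dw+g_2(x)u\,dt,\qquad E\{dw\,dw^T\}=\Sigma(t)\Sigma(t)^T\,dt,\qquad x\in\mathbb R^n,\ u\in\mathbb R^{m_2},$$ where $\Sigma(t)$ is an unknown bounded function with values in the nonnegative definite $r\times r$ matrices, and a nominal control law $u_0$. Let $h$ be an NSSf-CBF, with associated $\rho$ and $\alpha$ and $$\omega(x,u_0)=L_{f+g_2u_0}h(x)+\alpha(h)-\tfrac12\Big|g_1^T\frac{\partial^2h}{\partial x^2}g_1\Big|_{\mathcal F}\rho^{-1}(\max\{0,-h(x)\}).$$ Then, under $u=u_0+\bar u(x,u_0)$ with $\bar u$ either the Sontag-type control $$\bar u=\begin{cases}(L_{g_2}h)^T\,\dfrac{-\omega+\sqrt{\omega^2+(L_{g_2}h(L_{g_2}h)^T)^2}}{L_{g_2}h(L_{g_2}h)^T},&L_{g_2}h\neq0,\\[3mm]0,&L_{g_2}h=0,\end{cases}$$ or the QP control $$\bar u=\begin{cases}0,&\omega(x,u_0)\ge0,\\[1mm]-\dfrac{\omega(x,u_0)}{|L_{g_2}h|^2}(L_{g_2}h)^T,&\omega(x,u_0)<0,\end{cases}$$ the system satisfies the noise-to-state barrier function condition (NSBFc): for all $x$ and all $\Sigma$, $$\min\{0,h(x)\}\le-\rho\big(|\Sigma\Sigma^T|_{\mathcal F}\big)\ \Longrightarrow\ L_fh+L_{g_2}h\,u+\tfrac12{\rm Tr}\Big\{\Sigma^Tg_1^T\frac{\partial^2h}{\partial x^2}g_1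\Sigma\Big\}\ge-\alpha(h).$$
   Context: $f,g_1,g_2$ are locally Lipschitz. A barrier function candidate is (here) a twice differentiable $h:\mathbb R^n\to\mathbb R$ with $\inf h<0<\sup h$. Class $\mathcal K$: continuous strictly increasing functions vanishing at $0$ (on $[0,\infty)$). $\mathcal K_h$: continuous strictly increasing functions $(\inf h,\sup h)\to\mathbb R$ vanishing at $0$. $L_fh=\frac{\partial h}{\partial x}f$, $L_{g_2}h=\frac{\partial h}{\partial x}g_2$ (row vector). $|X|_{\mathcal F}=({\rm Tr}\{X^TX\})^{1/2}$ is the Frobenius norm; $|\cdot|$ is the Euclidean norm. NSSf-CBF: a barrier function candidate $h$ is a noise-to-state safety control barrier function if there are a class $\mathcal K$ function $\rho:[0,\infty)\to[0,-\inf h)$ and $\alpha\in\mathcal K_h$ such that, with $\omega(x,u_0)$ as defined in the claim, $L_{g_2}h=0\Rightarrow\omega\ge0$. It is understood that $\rho^{-1}(\max\{0,-h(x)\})$ and $\alpha(h(x))$ are defined for all $x$. *)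

(* Defs.v *)
(* MathComp-Analysis development: R : realType, states and inputs are column
   vectors. *)
From HB Require Import structures.
From mathcomp Require Import all_boot all_order all_algebra.
From mathcomp Require Import all_classical all_reals all_analysis.

Set Implicit Arguments.
Unset Strict Implicit.
Unset Printing Implicit Defensive.

Import Order.TTheory GRing.Theory Num.Theory.
Import numFieldNormedType.Exports.

Local Open Scope classical_set_scope.
Local Open Scope ring_scope.

(* On column and row vectors this is the Euclidean norm; the library norm
   `|X| on matrices is the sup norm instead. *)
Definition frob_norm (R : realType) p q (X : 'M[R]_(p, q)) : R :=
  Num.sqrt (\tr (X^T *m X)).

Definition nonneg_definite (R : realType) r (S : 'M[R]_r) : Prop :=
  S^T = S /\ forall v : 'cV[R]_r, 0 <= (v^T *m S *m v) 0 0.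

(* All norms on a matrix space being equivalent, the sup norm underlying
   [lipschitz _ | _] gives the usual notion. *)
Definition locally_lipschitz (R : realType) n p q
    (F : 'cV[R]_n -> 'M[R]_(p, q)) : Prop :=
  forall x : 'cV[R]_n, exists2 U : set 'cV[R]_n, nbhs x U & [lipschitz F y | y in U].

Section Calculus.
Variables (R : realType) (n : nat).
Implicit Types (h : 'cV[R]_n -> R) (x : 'cV[R]_n).

Definition gradient h x : 'rV[R]_n := \row_j 'D_(delta_mx j 0) h x.

Definition hessian h x : 'M[R]_n :=
  \matrix_(i, j) 'D_(delta_mx j 0) (fun y => gradient h y 0 i) x.

Definition twice_differentiable h : Prop :=
  (forall x, differentiable h x) /\ (forall x, differentiable (gradient h) x).

(* For a vector field (k = 1) the Lie derivative is the 1 x 1 matrix whose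
   entry at (0, 0) is the scalar L_F h. *)
Definition lie k h (F : 'cV[R]_n -> 'M[R]_(n, k)) x : 'rV[R]_k :=
  gradient h x *m F x.

Definition inf_fun h : \bar R := ereal_inf [set (h x)%:E | x in setT].
Definition sup_fun h : \bar R := ereal_sup [set (h x)%:E | x in setT].

Definition barrier_candidate h : Prop :=
  twice_differentiable h /\ (inf_fun h < 0%:E < sup_fun h)%E.

End Calculus.

Section ComparisonFunctions.
Variable R : realType.

Definition strictly_increasing_on (A : set R) (g : R -> R) : Prop :=
  forall s t, A s -> A t -> s < t -> g s < g t.

Definition class_K (rho : R -> R) : Prop :=
  [/\ {within `[0, +oo[, continuous rho},
      strictly_increasing_on `[0, +oo[ rho & rho 0 = 0].

(* The inverse of rho : [0, +oo[ -> R; meaningful on the image of rho only. *)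
Definition inv_K (rho : R -> R) : R -> R := 'pinv_(fun=> 0) `[0, +oo[ rho.

Definition open_range n (h : 'cV[R]_n -> R) : set R :=
  [set y | (inf_fun h < y%:E < sup_fun h)%E].

Definition class_Kh n (h : 'cV[R]_n -> R) (alpha : R -> R) : Prop :=
  [/\ {within open_range h, continuous alpha},
      strictly_increasing_on (open_range h) alpha & alpha 0 = 0].

End ComparisonFunctions.

Section SafetyFilter.
Variables (R : realType) (n m r : nat).
Variables (f : 'cV[R]_n -> 'cV[R]_n) (g1 : 'cV[R]_n -> 'M[R]_(n, r))
  (g2 : 'cV[R]_n -> 'M[R]_(n, m)).
Variables (h : 'cV[R]_n -> R) (rho alpha : R -> R).

Definition omega (u0 : 'cV[R]_n -> 'cV[R]_m) (x : 'cV[R]_n) : R :=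
  lie h (fun y => f y + g2 y *m u0 y) x 0 0 + alpha (h x)
  - 2^-1 * frob_norm ((g1 x)^T *m hessian h x *m g1 x)
         * inv_K rho (Num.max 0 (- h x)).

(* The image and open_range clauses say that rho^-1(max{0, -h(x)}) and
   alpha(h(x)) are defined at every x; they force inf h and sup h not to be
   attained and rho to be onto [0, - inf h[. *)
Definition NSSf_CBF (u0 : 'cV[R]_n -> 'cV[R]_m) : Prop :=
  barrier_candidate h /\
  [/\ class_K rho, forall s : R, 0 <= s -> ((rho s)%:E < - inf_fun h)%E
    & class_Kh h alpha] /\
  [/\ forall x, (rho @` `[0, +oo[) (Num.max 0 (- h x)),
      forall x, open_range h (h x)
    & forall x, lie h g2 x = 0 -> 0 <= omega u0 x].

Definition sontag_control (u0 : 'cV[R]_n -> 'cV[R]_m) (x : 'cV[R]_n) :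
    'cV[R]_m :=
  let b := lie h g2 x in
  let bb := (b *m b^T) 0 0 in
  let w := omega u0 x in
  if b == 0 then 0
  else ((- w + Num.sqrt (w ^+ 2 + bb ^+ 2)) / bb) *: b^T.

Definition qp_control (u0 : 'cV[R]_n -> 'cV[R]_m) (x : 'cV[R]_n) :
    'cV[R]_m :=
  let b := lie h g2 x in
  let w := omega u0 x in
  if 0 <= w then 0 else - (w / frob_norm b ^+ 2) *: b^T.

(* Sigma ranges over the values an admissible noise intensity Sigma(t), with
   E{dw dw^T} = Sigma(t) Sigma(t)^T dt, can take. *)
Definition NSBFc (u : 'cV[R]_n -> 'cV[R]_m) : Prop :=
  forall (x : 'cV[R]_n) (Sigma : 'M[R]_r), nonneg_definite Sigma ->
    Num.min 0 (h x) <= - rho (frob_norm (Sigma *m Sigma^T)) ->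
    - alpha (h x) <= lie h f x 0 0 + (lie h g2 x *m u x) 0 0
      + 2^-1 * \tr (Sigma^T *m (g1 x)^T *m hessian h x *m g1 x *m Sigma).

End SafetyFilter.

(* Main.v *)
(* With u = u0 + ubar the NSBF condition holds as soon as
   omega + L_{g2}h ubar >= 0.  Indeed |Sigma Sigma^T|_F <= rho^-1(max{0, -h})
   by monotonicity of rho, so Cauchy-Schwarz for the Frobenius inner product
   bounds the diffusion term below by the term that omega subtracts.  Both
   controls satisfy omega + L_{g2}h ubar >= 0: the Sontag control turns it into
   sqrt(omega^2 + |L_{g2}h|^4) and the QP control into max{0, omega}, the case
   L_{g2}h = 0 being the barrier assumption. *)
Require Import Defs.
From HB Require Import structures.
From mathcomp Require Import all_boot all_order all_algebra.
From mathcomp Require Import all_classical all_reals all_analysis.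
From mathcomp Require Import ring lra.
Import Order.TTheory GRing.Theory Num.Theory.
Import numFieldNormedType.Exports.
Local Open Scope classical_set_scope.
Local Open Scope ring_scope.

Lemma mxtrace_gram {R : realType} {p q} (X : 'M[R]_(p, q)) :
  \tr (X^T *m X) = \sum_i \sum_j X j i ^+ 2.
Proof.
apply: eq_bigr => i _; rewrite mxE; apply: eq_bigr => j _.
by rewrite mxE expr2.
Qed.

Lemma mxtrace_gram_ge0 {R : realType} {p q} (X : 'M[R]_(p, q)) :
  0 <= \tr (X^T *m X).
Proof.
by rewrite mxtrace_gram; do 2!apply: sumr_ge0 => ? _; exact: sqr_ge0.
Qed.

Lemma mxtrace_gram_eq0 {R : realType} {p q} (X : 'M[R]_(p, q)) :
  \tr (X^T *m X) = 0 -> X = 0.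
Proof.
rewrite mxtrace_gram => X0; apply/matrixP => j i; rewrite mxE; apply/eqP.
have col0 : \sum_j X j i ^+ 2 = 0.
  by apply: (psumr_eq0P _ X0) => // k _; apply: sumr_ge0 => ? _; exact: sqr_ge0.
rewrite -sqrf_eq0 (psumr_eq0P (F := fun j => X j i ^+ 2) _ col0) //.
by move=> k _; exact: sqr_ge0.
Qed.

Lemma frob_norm_ge0 {R : realType} {p q} (X : 'M[R]_(p, q)) : 0 <= frob_norm X.
Proof. exact: sqrtr_ge0. Qed.

Lemma sqr_frob_norm {R : realType} {p q} (X : 'M[R]_(p, q)) :
  frob_norm X ^+ 2 = \tr (X^T *m X).
Proof. by rewrite sqr_sqrtr // mxtrace_gram_ge0. Qed.

Lemma frob_norm_trmx {R : realType} {p q} (X : 'M[R]_(p, q)) :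
  frob_norm X^T = frob_norm X.
Proof. by rewrite /frob_norm trmxK mxtrace_mulC. Qed.

(** Discriminant argument: after squaring, the claim is [c ^+ 2 <= a * b], read off from the squared
    norm of one combination of [X] and [Y]; when [b = 0], [Y] vanishes. *)
Lemma frob_cauchy_schwarz {R : realType} {p q} (X Y : 'M[R]_(p, q)) :
  `|\tr (X^T *m Y)| <= frob_norm X * frob_norm Y.
Proof.
set c := \tr _.
rewrite -(@ler_pXn2r _ 2) ?nnegrE ?mulr_ge0 ?frob_norm_ge0 ?normr_ge0 //.
rewrite real_normK ?num_real // exprMn !sqr_frob_norm.
set a := \tr (X^T *m X); set b := \tr (Y^T *m Y).
have b_ge0 : 0 <= b by exact: mxtrace_gram_ge0.
have YX : \tr (Y^T *m X) = c by rewrite -mxtrace_tr trmx_mul trmxK.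
have [b0|b_neq0] := eqVneq b 0.
  have -> : c = 0 by rewrite /c (mxtrace_gram_eq0 _ b0) mulmx0 mxtrace0.
  by rewrite expr0n mulr_ge0 ?mxtrace_gram_ge0.
have : 0 <= b * (a * b - c ^+ 2).
  (* This is [b] times the component of [X] orthogonal to [Y], with denominators cleared; its
     squared norm is [b * (a * b - c ^+ 2)]. *)
  have := mxtrace_gram_ge0 (b *: X - c *: Y).
  rewrite [(_ - _)^T]linearB /= ![(_ *: _)^T]linearZ /= mulmxBl !mulmxBr.
  rewrite -!scalemxAl -!scalemxAr !(raddfB, mxtraceZ) /= !mxtraceZ.
  rewrite YX -/a -/b -/c.
  by congr (0 <= _); ring.
by rewrite pmulr_rge0 ?subr_ge0 // lt_def b_neq0.
Qed.

Lemma class_K_le {R : realType} {rho : R -> R} {s t : R} :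
  class_K rho -> 0 <= s -> 0 <= t -> rho s <= rho t -> s <= t.
Proof.
move=> [_ rho_incr _] s0 t0; rewrite !leNgt; apply: contra => ts.
by apply: rho_incr; rewrite //= in_itv /= andbT.
Qed.

(** On the image of [rho], [inv_K] is a true inverse rather than the default 0, so writing
    [y = rho t] reduces the claim to [s <= t]. *)
Lemma inv_K_ge {R : realType} {rho : R -> R} {s y : R} :
  class_K rho -> (rho @` `[0, +oo[) y -> 0 <= s -> rho s <= y ->
  s <= inv_K rho y.
Proof.
move=> rhoK [t /= t_ge0 <-{y}] s_ge0 rho_st.
have ge0 z : z \in (`[0, +oo[%classic : set R) -> 0 <= z.
  by rewrite inE /= in_itv /= andbT.
rewrite /inv_K pinvKV; last by rewrite inE.
- by apply: class_K_le rho_st => //; apply: ge0; rewrite inE.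
(* The cancellation needs injectivity, obtained by reflecting the order in both directions. *)
- move=> u v /ge0 u0 /ge0 v0 uv.
  by apply/le_anti/andP; split; apply: class_K_le rhoK _ _ _; rewrite ?uv.
Qed.

Section SafetyFilterCorrectness.
Variables (R : realType) (n m r : nat).
Variables (f : 'cV[R]_n -> 'cV[R]_n) (g1 : 'cV[R]_n -> 'M[R]_(n, r))
  (g2 : 'cV[R]_n -> 'M[R]_(n, m)) (u0 : 'cV[R]_n -> 'cV[R]_m).
Variables (h : 'cV[R]_n -> R) (rho alpha : R -> R).
Hypothesis h_cbf : NSSf_CBF f g1 g2 h rho alpha u0.

Lemma NSBFc_of_omega_ge0 (ubar : 'cV[R]_n -> 'cV[R]_m) :
  (forall x, 0 <= omega f g1 g2 h rho alpha u0 x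
                  + (lie h g2 x *m ubar x) 0 0) ->
  NSBFc f g1 g2 h rho alpha (fun x => u0 x + ubar x).
Proof.
move=> omega_ubar x S _ rhoS.
have [_ [[rhoK _ _] [rho_img _ _]]] := h_cbf.
have s_le : frob_norm (S *m S^T) <= inv_K rho (Num.max 0 (- h x)).
  apply: inv_K_ge => //; first exact: frob_norm_ge0.
  by move: rhoS; rewrite lerNr oppr_min oppr0.
pose A := (g1 x)^T *m hessian h x *m g1 x.
(* The double transpose gives the trace the shape required by [frob_cauchy_schwarz] at [A^T], whose
   norm is that of [A]. *)
have trE : \tr (S^T *m (g1 x)^T *m hessian h x *m g1 x *m S)
           = \tr (A^T^T *m (S *m S^T)).
  by rewrite trmxK -!mulmxA mxtrace_mulC /A !mulmxA.
have trA : - (frob_norm A * inv_K rho (Num.max 0 (- h x)))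
           <= \tr (A^T^T *m (S *m S^T)).
  have := frob_cauchy_schwarz A^T (S *m S^T); rewrite frob_norm_trmx.
  rewrite ler_norml => /andP[+ _]; apply: le_trans.
  by rewrite lerN2 ler_wpM2l // frob_norm_ge0.
have addE p q (B C : 'M[R]_(p, q)) i j : (B + C) i j = B i j + C i j.
  by rewrite mxE.
have := omega_ubar x; rewrite /omega -/A trE /lie !mulmxDr !addE mulmxA.
by move: trA; lra.
Qed.

Lemma omega_sontag_ge0 x :
  0 <= omega f g1 g2 h rho alpha u0 x
       + (lie h g2 x *m sontag_control f g1 g2 h rho alpha u0 x) 0 0.
Proof.
have [_ [_ [_ _ omega_ge0]]] := h_cbf.
rewrite /sontag_control; case: eqP => [b0|b_neq0].
  by rewrite mulmx0 mxE addr0 omega_ge0.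
rewrite -scalemxAr mxE mulfVK.
  by rewrite addrC addrAC addNr add0r sqrtr_ge0.
(* The denominator is the trace of the Gram matrix of [b], hence nonzero when [b] is. *)
apply/eqP => bb0; apply: b_neq0; apply: mxtrace_gram_eq0.
by rewrite mxtrace_mulC /mxtrace big_ord1.
Qed.

Lemma omega_qp_ge0 x :
  0 <= omega f g1 g2 h rho alpha u0 x
       + (lie h g2 x *m qp_control f g1 g2 h rho alpha u0 x) 0 0.
Proof.
have [_ [_ [_ _ omega_ge0]]] := h_cbf.
rewrite /qp_control; case: ifPn => [w_ge0|w_lt0].
  by rewrite mulmx0 mxE addr0.
rewrite -scalemxAr mxE sqr_frob_norm mxtrace_mulC {1}/mxtrace big_ord1.
(* The quotient cancels to [- omega], giving sum 0. A zero denominator would mean [lie h g2 x = 0],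
   where the barrier assumption contradicts [omega < 0]. *)
rewrite mulNr divfK ?subrr //; apply: contraNneq w_lt0 => bb0.
apply: omega_ge0; apply: mxtrace_gram_eq0.
by rewrite mxtrace_mulC /mxtrace big_ord1.
Qed.

End SafetyFilterCorrectness.

Theorem theorem10 (R : realType) (n m2 r : nat)
  (f : 'cV[R]_n -> 'cV[R]_n)
  (g1 : 'cV[R]_n -> 'M[R]_(n, r))
  (g2 : 'cV[R]_n -> 'M[R]_(n, m2))
  (f_lip : locally_lipschitz f)
  (g1_lip : locally_lipschitz g1)
  (g2_lip : locally_lipschitz g2)
  (u0 : 'cV[R]_n -> 'cV[R]_m2)
  (h : 'cV[R]_n -> R) (rho alpha : R -> R)
  (h_cbf : NSSf_CBF f g1 g2 h rho alpha u0) :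
  NSBFc f g1 g2 h rho alpha
    (fun x => u0 x + sontag_control f g1 g2 h rho alpha u0 x) /\
  NSBFc f g1 g2 h rho alpha
    (fun x => u0 x + qp_control f g1 g2 h rho alpha u0 x).
Proof.
split; apply: NSBFc_of_omega_ge0 => // x.
- exact: omega_sontag_ge0.
- exact: omega_qp_ge0.
Qed.
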